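(* Let $G$ be a finite group and $x,y\in G$. Let $\psi$ be a character of $G$ with $\psi(x)=\psi(y)\neq 0$. (1) Assume that $x^G,y^G$ is a critical pair for $I\subset\mathrm{Irr}(G)$. Then for any $\chi\in I$, the product $\psi\cdot\chi$ has a constituent in $I$. In particular, if $\psi$ is irreducible and $\chi\in I$, then $\chi\cdot\sum_{\nu\in I}\nu$ contains $\psi$ as a constituent. (2) Assume that $x^G,y^G$ is a detecting pair for $\chi_1,\chi_2\in\mathrm{Irr}(G)$. Set $m_j=\langle\psi\cdot\chi_1,\chi_j\rangle$, $j=1,2$. Then $\psi(x)=m_1-m_2$. Furthermore, $\max(m_1,m_2)\ge|\psi(x)|>0$.
   Context: Characters are complex characters; $\mathrm{Irr}(G)$ is the set of irreducible characters of $G$; $x^G$ is the conjugacy class of $x$; $\langle\cdot,\cdot\rangle$ is the usual inner product of characters. For $I\subset\mathrm{Irr}(G)$, a pair of conjugacy classes $x^G,y^G$ is called critical for $I$ if $\chi(x)\neq\chi(y)$ for all $\chi\in I$, and $\chi(x)=\chi(y)$ for all $\chi\in\mathrm{Irr}(G)\setminus I$. A critical pair $x^G,y^G$ for a two-element set $I=\{\chi_1,\chi_2\}\subset\mathrm{Irr}(G)$ is called a pair of detecting classes (a detecting pair) for $\chi_1,\chi_2$ if $\chi_1(x)-\chi_1(y)=\chi_2(y)-\chi_2(x)$. *)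

(* Defs.v *)
From mathcomp Require Import all_boot all_order all_algebra all_fingroup.
From mathcomp Require Import all_solvable all_field all_character.
Set Implicit Arguments.
Unset Strict Implicit.
Unset Printing Implicit Defensive.
Import Order.TTheory GRing.Theory Num.Theory.
Local Open Scope ring_scope.

(* The classes x ^: G and y ^: G are given by representatives x, y \in G:
   class functions on G are constant on them.  Irreducible characters are
   designated by their indices in Iirr G, which are in bijection with Irr(G). *)
Definition critical_pair (gT : finGroupType) (G : {group gT})
    (I : {set Iirr G}) (x y : gT) : Prop :=
  [/\ x \in G, y \in G,
      forall i : Iirr G, i \in I -> 'chi_i x <> 'chi_i y
    & forall i : Iirr G, i \notin I -> 'chi_i x = 'chi_i y].

Definition detecting_pair (gT : finGroupType) (G : {group gT})
    (i1 i2 : Iirr G) (x y : gT) : Prop :=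
  [/\ i1 != i2, critical_pair [set i1; i2] x y
    & 'chi_i1 x - 'chi_i1 y = 'chi_i2 y - 'chi_i2 x].

(* Main.v *)
Require Import Defs.
From mathcomp Require Import all_boot all_order all_algebra all_fingroup.
From mathcomp Require Import all_solvable all_field all_character.
Set Implicit Arguments.
Unset Strict Implicit.
Unset Printing Implicit Defensive.
Import Order.TTheory GRing.Theory Num.Theory.
Local Open Scope ring_scope.

(** Since psi x = psi y, the jump of psi * chi between x and y is psi x times
    the jump of chi. Expanding psi * chi in irreducible characters, only the
    members of I contribute to that jump; it is nonzero when chi \in I, so some
    member of I occurs, and for a detecting pair the two contributions are
    m1 and - m2 times the jump of chi_1. *)

(** Irreducible characters outside [I] agree at [x] and [y], so their terms cancel in the expansion
    of [phi]. *)
Lemma critical_pair_jump (gT : finGroupType) (G : {group gT})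
    (I : {set Iirr G}) (x y : gT) (phi : 'CF(G)) :
  critical_pair I x y ->
  phi x - phi y = \sum_(j in I) '[phi, 'chi_j] * ('chi_j x - 'chi_j y).
Proof.
move=> [_ _ _ eqxy]; rewrite {1 2}(cfun_sum_cfdot phi) !sum_cfunE -sumrB.
rewrite [RHS]big_mkcond /=; apply: eq_bigr => j _; rewrite !cfunE -mulrBr.
by case: ifPn => // /eqxy ->; rewrite subrr mulr0.
Qed.

(** Complex conjugation is injective, so a character and its conjugate separate the same pairs of
    elements. *)
Lemma critical_pair_conjC (gT : finGroupType) (G : {group gT})
    (I : {set Iirr G}) (x y : gT) (i : Iirr G) :
  critical_pair I x y -> i \in I -> conjC_Iirr i \in I.
Proof.
move=> [_ _ neqxy eqxy] Ii; apply/negPn/negP => /eqxy.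
by rewrite conjC_IirrE !cfunE => /(can_inj conjCK) /(neqxy i Ii).
Qed.

Lemma critical_pair_constt_mul (gT : finGroupType) (G : {group gT})
    (I : {set Iirr G}) (x y : gT) (psi : 'CF(G)) (i : Iirr G) :
  critical_pair I x y -> psi x = psi y -> psi y != 0 -> i \in I ->
  exists2 j : Iirr G, j \in I & j \in irr_constt (psi * 'chi_i).
Proof.
move=> crit psi_xy psi_y0 Ii; apply/exists_inP; apply: contraT.
rewrite negb_exists_in => /forall_inP noconstt.
have := critical_pair_jump (psi * 'chi_i) crit.
rewrite !cfunE psi_xy -mulrBr big1 => [/eqP|j /noconstt]; last first.
  by rewrite irr_consttE negbK => /eqP->; rewrite mul0r.
case: crit => _ _ /(_ i Ii) neqxy _.
by rewrite mulf_eq0 (negPf psi_y0) subr_eq0 => /eqP.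
Qed.

Lemma cfdot_mull (gT : finGroupType) (G : {group gT}) (phi chi psi : 'CF(G)) :
  '[phi * chi, psi] = '[chi, psi * (phi^*)%CF].
Proof.
rewrite !cfdotE; congr (_ * _); apply: eq_bigr => z _.
by rewrite !cfunE rmorphM /= conjCK [phi z * _]mulrC -mulrA [phi z * _]mulrC.
Qed.

(** The order may be partial, as on complex numbers; nonnegativity is what makes [a] and [b]
    comparable. *)
Lemma normB_le_max (R : numDomainType) (a b : R) :
  0 <= a -> 0 <= b -> `|a - b| <= Num.max a b.
Proof.
move=> a0 b0.
by have [_|_] := real_leP (ger0_real a0) (ger0_real b0); rewrite gerBl.
Qed.

Theorem lemma2p3 (gT : finGroupType) (G : {group gT}) (x y : gT)
    (xG : x \in G) (yG : y \in G)
    (psi : 'CF(G)) (psi_char : psi \is a character)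
    (psi_xy : psi x = psi y) (psi_y0 : psi y <> 0) :
  (forall I : {set Iirr G}, critical_pair I x y ->
     (forall i : Iirr G, i \in I ->
        exists2 j : Iirr G, j \in I & j \in irr_constt (psi * 'chi_i))
     /\
     (forall k : Iirr G, psi = 'chi_k ->
        forall i : Iirr G, i \in I ->
        k \in irr_constt ('chi_i * \sum_(j in I) 'chi_j)))
  /\
  (forall i1 i2 : Iirr G, detecting_pair i1 i2 x y ->
     let m1 := '[psi * 'chi_i1, 'chi_i1] in
     let m2 := '[psi * 'chi_i1, 'chi_i2] in
     [/\ psi x = m1 - m2,
         `|psi x| <= Num.max m1 m2
       & 0 < `|psi x|]).
Proof.
move/eqP: psi_y0 => psi_y0; split=> [I crit | i1 i2 [neq12 crit jump] m1 m2].
  split=> [i Ii | k def_psi i Ii].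
    exact: critical_pair_constt_mul crit _ _ Ii.
  (* Moving chi_i across the inner product conjugates it, and I is stable under
     conjugation. *)
  have [j Ij] := critical_pair_constt_mul crit psi_xy psi_y0
                   (critical_pair_conjC crit Ii).
  rewrite conjC_IirrE def_psi !irr_consttE mulr_sumr cfdot_suml => nz.
  (* Inner products of characters are natural numbers, so nothing cancels: one positive term, at
     [j], is enough. *)
  rewrite gt_eqF // (bigD1 j) //= ltr_wpDr //.
    apply: sumr_ge0 => l _.
    by rewrite natr_ge0 // Cnat_cfdot_char ?rpredM ?irr_char.
  rewrite lt_def natr_ge0 ?Cnat_cfdot_char ?rpredM ?irr_char // andbT.
  (* The inner product of two characters is symmetric, which turns the goal into [nz]. *)
  by rewrite cfdot_mull cfdotC_char ?rpredM ?cfConjC_char ?irr_char.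
have [_ _ neqxy _] := crit.
have psiE : psi x = m1 - m2.
  have neq1 : 'chi_i1 x - 'chi_i1 y != 0.
    by rewrite subr_eq0; apply/eqP/neqxy; rewrite !inE eqxx.
  (* The identity is checked after multiplying by the nonzero jump of ['chi_i1]. *)
  apply: (mulIf neq1); rewrite mulrBl.
  have := critical_pair_jump (psi * 'chi_i1) crit.
  rewrite big_setU1 ?inE //= big_set1 !cfunE -psi_xy -mulrBr => ->.
  by rewrite jump -mulrN opprB.
have m_ge0 j : 0 <= '[psi * 'chi_i1, 'chi_j].
  by apply: natr_ge0; rewrite Cnat_cfdot_char ?rpredM ?irr_char.
split=> //; last by rewrite normr_gt0 psi_xy.
by rewrite psiE normB_le_max ?m_ge0.
Qed.
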